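(* Let $n\ge 2$ be an integer and let $A\subseteq\mathbb{F}_{2^{n-1}}\setminus\{0\}$ with $|A|=k$. Then there exists a subset of $\mathbb{F}_{2^n}\setminus\{0\}$ of size $2k+1$ whose $r$-value is $4r(A)+6k$.
   Context: For a subset $X$ of a finite additive abelian group, the $r$-value $r(X)$ is the number of ordered pairs $(x,y)\in X\times X$ with $x+y\in X$. Only the additive group of $\mathbb{F}_{2^n}$ is used: its elements are written as vectors $[\alpha_1,\dots,\alpha_n]$ with $\alpha_i\in\{0,1\}$ and addition coordinatewise modulo 2. By convention $\mathbb{F}_{2^{n-1}}$ is regarded as the subset of $\mathbb{F}_{2^n}$ consisting of the vectors with first coordinate $\alpha_1=0$. *)

(* Defs.v *)
From mathcomp Require Import all_boot all_order all_algebra.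
Set Implicit Arguments.
Unset Strict Implicit.
Unset Printing Implicit Defensive.
Import GRing.Theory.
Local Open Scope ring_scope.

Definition rvalue (G : finZmodType) (X : {set G}) : nat :=
  #|[set p in setX X X | p.1 + p.2 \in X]|.

(* The additive group of the field with 2 ^ n elements; coordinates are        *)
(* numbered from 0, so the first coordinate is the one of index 0.             *)
Notation F2n n := 'rV['F_2]_n.

(* The field with 2 ^ (n - 1) elements, as a subset of F2n n. For n > 0 exactly *)
(* one index i : 'I_n has value 0; quantifying over i avoids a proof of 0 < n.  *)
Definition F2n_pred (n : nat) : {set F2n n} :=
  [set v : F2n n | [forall i : 'I_n, (val i == 0%N) ==> (v 0 i == 0)]].

(* Main.v *)
Require Import Defs.
From HB Require Import structures.
From mathcomp Require Import all_boot all_order all_algebra zify.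
Set Implicit Arguments.
Unset Strict Implicit.
Unset Printing Implicit Defensive.
Import GRing.Theory.
Local Open Scope ring_scope.

(** Let [f] be the projection of [F2n n] onto [F2n_pred n] that erases the first
coordinate; it is additive and all its fibres over [F2n_pred n] have two
elements. The required set is [B = f @^-1: (0 |: A) :\ 0]. Two rules compute its
r-value.

Pulling a set [X] back along an additive map whose fibres over [X] have [c]
elements multiplies the size by [c] and the r-value by [c ^ 2], because the condition
[x + y \in f @^-1: X] depends only on [f x] and [f y] ([rvalue_preimset]).

Adding [0] to a symmetric set [X] that misses it raises the r-value by
[3 * #|X| + 1]: the new pairs are [(0, y)], [(x, 0)] and [(x, - x)]
([rvalue_setU10]).

So the r-value of [f @^-1: (0 |: A)] is [4 * (rvalue A + 3 * k + 1)]. This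
preimage is also [0 |: B], where [B] has [2 * (k + 1) - 1 = 2 * k + 1] elements,
so its r-value is [rvalue B + 3 * (2 * k + 1) + 1]. Subtracting
leaves [rvalue B = 4 * rvalue A + 6 * k]. *)

Lemma card_preimset_fibers (aT rT : finType) (f : aT -> rT) (D : {set rT})
    (c : nat) :
  {in D, forall y, #|f @^-1: [set y]| = c} -> #|f @^-1: D| = (c * #|D|)%N.
Proof.
move=> fibD; rewrite -sum1_card (partition_big f (mem D)) /=; last first.
  by move=> x; rewrite inE.
rewrite mulnC -sum_nat_const; apply: eq_bigr => y Dy.
rewrite -(fibD y Dy) -sum1_card; apply: eq_bigl => x.
by rewrite !inE; case: eqP => [->|]; rewrite ?Dy ?andbF.
Qed.

(** Additivity makes the set of pairs counted for [f @^-1: X] the preimage,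
under [f] taken on both coordinates, of the set of pairs counted for [X]; the
fibres of this map of pairs are products of two fibres of [f]. *)
Lemma rvalue_preimset (G H : finZmodType) (f : {additive G -> H})
    (X : {set H}) (c : nat) :
  {in X, forall y, #|f @^-1: [set y]| = c} ->
  rvalue (f @^-1: X) = (c ^ 2 * rvalue X)%N.
Proof.
move=> fibX; pose ff p := (f p.1, f p.2).
rewrite /rvalue -(@card_preimset_fibers _ _ ff).
  by apply: eq_card => -[x y]; rewrite !inE /= raddfD.
case=> u v; rewrite !inE /= => /andP[/andP[Xu Xv] _].
rewrite expnS expn1 -{1}(fibX u Xu) -(fibX v Xv) -cardsX.
by apply: eq_card => -[x y]; rewrite !inE.
Qed.

(** A pair counted for [0 |: X] but not for [X] has a zero entry or a zero sum.
The symmetry of [X] makes [(x, - x)] such a pair for every [x] in [X]; since [X]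
misses [0], the three kinds of new pairs do not overlap, apart from [(0, 0)],
which is counted among the pairs [(0, y)]. *)
Lemma rvalue_setU10 (G : finZmodType) (X : {set G}) :
  0 \notin X -> {in X, forall x, - x \in X} ->
  rvalue (0 |: X) = (rvalue X + 3 * #|X| + 1)%N.
Proof.
move=> X0 XN.
have nz x : x \in X -> (x == 0) = false.
  by move=> Xx; apply/eqP => x0; rewrite -x0 Xx in X0.
pose P := [set p in setX X X | p.1 + p.2 \in X].
pose D := [set (x, - x) | x in X].
have inD x y : ((x, y) \in D) = (x \in X) && (y == - x).
  apply/imsetP/andP => [[z Xz [-> ->]]|[Xx /eqP->]]; first by rewrite Xz eqxx.
  by exists x.
have cardD : #|D| = #|X| by rewrite card_imset // => x y [].
have cardUdisj (S T : {set G * G}) :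
    (forall x y, (x, y) \in S -> (x, y) \in T -> false) ->
    #|S :|: T| = (#|S| + #|T|)%N.
  move=> ST; apply/eqP; rewrite (leq_card_setU S T).2 -setI_eq0.
  apply/eqP/setP => -[x y]; rewrite !inE; apply/negP => /andP[xS xT].
  by have := ST _ _ xS xT.
have -> : rvalue (0 |: X)
    = #|((P :|: D) :|: setX X [set 0]) :|: setX [set 0] (0 |: X)|.
  apply: eq_card => -[x y]; rewrite !(inE, inD) /=.
  have [->|x0] := eqVneq x 0.
    by rewrite add0r (negPf X0) /= andbb.
  case Xx: (x \in X) => //=; rewrite orbF.
  have [->|y0] := eqVneq y 0; first by rewrite addr0 Xx !orbT.
  rewrite orbF addrC addr_eq0 /=.
  have [->|yx] := eqVneq y (- x); first by rewrite XN ?orbT.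
  by rewrite /= orbF.
rewrite !cardUdisj.
- rewrite cardD !cardsX !cards1 cardsU1 /rvalue -/P.
  (* [set] identifies cardinals typed by convertible structures on [G], which
     [lia] would take for distinct atoms. *)
  rewrite X0 -!addnA; congr addn; set m := #|X|; lia.
- move=> x y; rewrite !(inE, inD) /= => /andP[_ Sxy] /andP[_ /eqP yx].
  by move: Sxy; rewrite yx subrr (negPf X0).
- move=> x y; rewrite !(inE, inD) /= => PD /andP[Xx /eqP y0].
  by move: PD; rewrite y0 (negPf X0) Xx /= eq_sym oppr_eq0 (nz x).
- move=> x y; rewrite !(inE, inD) /= => PD /andP[/eqP x0 _].
  by move: PD; rewrite x0 (negPf X0).
Qed.

Lemma oppr_F2n (n : nat) (v : F2n n) : - v = v.
Proof. by apply/rowP => i; rewrite mxE oppr_pchar2 // pchar_Fp. Qed.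

(** Indexing by [n.+1] makes the erased coordinate available as [ord0]. *)
Definition erase0 (n : nat) (v : F2n n.+1) : F2n n.+1 :=
  \row_i (if i == ord0 then 0 else v 0 i).

Lemma erase0_is_zmod_morphism (n : nat) : zmod_morphism (@erase0 n).
Proof.
by move=> u v; apply/rowP => i; rewrite !mxE; case: eqP; rewrite ?subrr.
Qed.

HB.instance Definition _ (n : nat) :=
  GRing.isZmodMorphism.Build (F2n n.+1) (F2n n.+1) (@erase0 n)
    (@erase0_is_zmod_morphism n).

Lemma F2n_predE (n : nat) (v : F2n n.+1) :
  (v \in F2n_pred n.+1) = (v 0 ord0 == 0).
Proof.
rewrite inE; apply/forallP/idP => [/(_ ord0) //|v0 i].
by apply/implyP => i0; rewrite (_ : i = ord0) //; apply/val_inj/eqP.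
Qed.

(** An element of the fibre over [u] is determined by its first coordinate, which
can be either of the two elements of ['F_2]. *)
Lemma card_erase0_fiber (n : nat) (u : F2n n.+1) :
  u \in F2n_pred n.+1 -> #|@erase0 n @^-1: [set u]| = 2%N.
Proof.
rewrite F2n_predE => /eqP u0.
pose g (a : 'F_2) : F2n n.+1 := \row_i (if i == ord0 then a else u 0 i).
have -> : @erase0 n @^-1: [set u] = g @: [set: 'F_2].
  apply/setP => v; rewrite !inE; apply/eqP/imsetP => [vu|[a _ ->]].
    exists (v 0 ord0) => //; apply/rowP => i; rewrite mxE -vu mxE.
    by case: eqP => [->|].
  by apply/rowP => i; rewrite !mxE; case: eqP => [->|].
rewrite card_imset ?cardsT ?card_Fp // => a b /rowP/(_ ord0).
by rewrite !mxE eqxx.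
Qed.

Theorem proposition4p15 (n : nat) (hn : (2 <= n)%N) (k : nat) (A : {set F2n n})
    (hA : A \subset F2n_pred n :\ 0) (hk : #|A| = k) :
  exists B : {set F2n n},
    [/\ B \subset [set: F2n n] :\ 0, #|B| = (2 * k + 1)%N
      & rvalue B = (4 * rvalue A + 6 * k)%N].
Proof.
case: n hn A hA hk => // n _ A /subsetP hA hk.
have A0 : 0 \notin A by apply/negP => /hA; rewrite !inE eqxx.
(* The fibre over [0] is part of the pullback: it is {0, e}, e being the first
   basis vector, and e is the odd element of the answer. *)
have fib : {in 0 |: A, forall u, #|@erase0 n @^-1: [set u]| = 2%N}.
  move=> u /setU1P[->|/hA/setD1P[_ uP]]; apply: card_erase0_fiber => //.
  by rewrite F2n_predE mxE.
pose C := @erase0 n @^-1: (0 |: A).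
have C0 : 0 \in C by rewrite inE raddf0 setU11.
have cardB : #|C :\ 0| = (2 * k + 1)%N.
  have := card_preimset_fibers fib; rewrite -/C (cardsD1 0 C) C0 cardsU1 A0 hk.
  by set m := #|C :\ 0|; lia.
have sym (X : {set F2n n.+1}) : {in X, forall x, - x \in X}.
  by move=> x; rewrite oppr_F2n.
exists (C :\ 0); split=> //; first by apply: setSD; apply: subsetT.
have := @rvalue_preimset _ _ (@erase0 n) _ _ fib.
rewrite -/C -[in X in X = _ -> _](setD1K C0) !rvalue_setU10 ?setD11 // cardB hk.
by set r := rvalue (C :\ 0); lia.
Qed.
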